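(* Let $G$ be a finite group. Then $d(G)$ can be determined from the knowledge of $\Lambda^*(G)$; that is, if $G$ and $H$ are finite groups with $\Lambda^*(G)=\Lambda^*(H)$, then $d(G)=d(H)$.
   Context: For a finite group $G$, $d(G)$ is the smallest cardinality of a generating set of $G$. For non-negative integers $a\leq b$, $\Gamma_{a,b}(G)$ is the undirected graph, possibly with loops, whose vertices are the elements of $G^a\cup G^b$ (a disjoint union if $a\neq b$, just $G^a$ if $a=b$; $G^0$ consists of the single empty tuple), in which $(x_1,\dots,x_a)\in G^a$ and $(y_1,\dots,y_b)\in G^b$ are adjacent if and only if $\langle x_1,\dots,x_a,y_1,\dots,y_b\rangle=G$. If $a\neq b$ there are no other edges; if $a=b$ there is a loop at $x\in G^a$ exactly when the entries of $x$ generate $G$. A vertex is isolated if it is adjacent to no vertex (itself included). $\Gamma^*_{a,b}(G)$ is obtained from $\Gamma_{a,b}(G)$ by deleting the isolated vertices. $\Lambda^*(G)$ is the collection of all the connected components of the graphs $\Gamma^*_{a,b}(G)$, for all non-negative integers $a\leq b$, regarded as abstract graphs (with their loops) up to isomorphism and counted with multiplicity; the labels $a,b$ from which each graph arises are not part of the data. Thus $\Lambda^*(G)=\Lambda^*(H)$ means that there is a bijection between the two collections matching isomorphic graphs. *)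

(* Defs.v *)
From HB Require Import structures.
From mathcomp Require Import all_boot all_fingroup all_solvable.

Set Implicit Arguments.
Unset Strict Implicit.
Unset Printing Implicit Defensive.

Local Open Scope group_scope.

(* Finite undirected graphs, loops allowed. *)
Record graph := Graph {
  vertex :> finType;
  adj : rel vertex;
  adj_sym : symmetric adj }.

Arguments adj {g} : rename.

Definition graph_iso (X Y : graph) : Prop :=
  exists2 f : X -> Y, bijective f & forall x y, adj (f x) (f y) = adj x y.

Section Graphs.
Variable X : graph.

Definition induced_adj (A : {set X}) : rel {x : X | x \in A} :=
  fun x y => adj (val x) (val y).

Fact induced_adj_sym (A : {set X}) : symmetric (@induced_adj A).
Proof. by move=> x y; apply: adj_sym. Qed.

Definition induced (A : {set X}) : graph := Graph (@induced_adj_sym A).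

(* [y] may be [x]: a vertex carrying a loop is not isolated. *)
Definition isolated (x : X) : bool := [forall y : X, ~~ adj x y].

Definition delete_isolated : graph := induced [set x | ~~ isolated x].

Definition components : {set {set X}} :=
  equivalence_partition (connect (@adj X)) [set: X].

End Graphs.

Section Gamma.
Variables (gT : finGroupType) (G : {group gT}) (a b : nat).

(* For a <= b, G^a and G^b both embed in the sequences of length at most b;
   as sets of sequences they are disjoint if a != b and equal if a = b. *)
Definition Gamma_vertex : finType :=
  {s : b.-bseq gT | (size s \in [:: a; b]) && all [in G] s}.

Definition Gamma_adj : rel Gamma_vertex := fun x y =>
  let s : seq gT := val x in
  let t : seq gT := val y in
  ((size s == a) && (size t == b) || (size s == b) && (size t == a))
  && (<<[set z in s ++ t]>> == G :> {set gT}).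

Fact Gamma_adj_sym : symmetric Gamma_adj.
Proof.
move=> x y; rewrite /Gamma_adj orbC [in RHS]andbC.
rewrite andbC; congr (_ && _).
  by congr (<<_>> == _); apply/setP=> z; rewrite !inE !mem_cat orbC.
by congr (_ || _); rewrite andbC.
Qed.

Definition Gamma : graph := Graph Gamma_adj_sym.

Definition Gamma_star : graph := delete_isolated Gamma.

End Gamma.

(* The collection Lambda^*(G) is the family of graphs [Lambda_graph C] indexed
   by [C : Lambda_star G], so that multiplicities are those of the family. *)
Record Lambda_star (gT : finGroupType) (G : {group gT}) := LambdaStar {
  Lambda_a : nat;
  Lambda_b : nat;
  Lambda_le : Lambda_a <= Lambda_b;
  Lambda_comp : {set Gamma_star G Lambda_a Lambda_b};
  Lambda_compP : Lambda_comp \in components (Gamma_star G Lambda_a Lambda_b) }.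

Definition Lambda_graph (gT : finGroupType) (G : {group gT})
    (C : Lambda_star G) : graph := induced (Lambda_comp C).

Definition Lambda_star_eq (gT rT : finGroupType)
    (G : {group gT}) (H : {group rT}) : Prop :=
  exists2 f : Lambda_star G -> Lambda_star H,
    bijective f & forall C, graph_iso (Lambda_graph C) (Lambda_graph (f C)).

(* Main.v *)
Require Import Defs.
From HB Require Import structures.
From mathcomp Require Import all_boot all_fingroup all_solvable.

(** Loops carry all the information that is needed.  A loop of [Gamma G a b]
    sits at a tuple [x] whose entries generate [G], and it forces [a = b]; such
    an [x] is adjacent to every vertex, so that no vertex is isolated and the
    whole graph is one component, with [#|G| ^ a] vertices.  A generating
    [a]-tuple exists exactly when [a] is at least [d(G)].  Hence the orders of
    the members of the family that carry a loop are the powers [#|G| ^ a] with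
    [d(G) <= a] ([looped_component_order], [looped_component_exists]), and this
    set of orders is an isomorphism invariant of the family.  The set is [{1}]
    exactly when [G] is trivial, and then [d(G) = 0]; otherwise its two least
    elements are [#|G| ^ d(G)] and [#|G| ^ d(G).+1], whose ratio is [#|G|], and
    this determines the exponent [d(G)] ([exponent_of_power_tail]). *)

Set Implicit Arguments.
Unset Strict Implicit.
Unset Printing Implicit Defensive.

Definition has_loop (X : graph) : Prop := exists x : X, adj x x.

Lemma graph_iso_sym (X Y : graph) : graph_iso X Y -> graph_iso Y X.
Proof.
case=> f [g fK gK] fadj; exists g; first by exists f.
by move=> x y; rewrite -fadj !gK.
Qed.

Lemma graph_iso_has_loop (X Y : graph) :
  graph_iso X Y -> has_loop X -> has_loop Y.
Proof. by case=> f _ fadj [x xx]; exists (f x); rewrite fadj. Qed.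

Lemma graph_iso_card (X Y : graph) : graph_iso X Y -> #|X| = #|Y|.
Proof. by case=> f fbij _; apply: bij_eq_card fbij. Qed.

Lemma Lambda_star_eq_sym (gT rT : finGroupType)
    (G : {group gT}) (H : {group rT}) :
  Lambda_star_eq G H -> Lambda_star_eq H G.
Proof.
case=> f [g fK gK] fiso; exists g; first by exists f.
by move=> D; apply: graph_iso_sym; rewrite -{2}[D]gK.
Qed.

Section LoopedComponents.
Variables (gT : finGroupType) (G : {group gT}).
Implicit Types a b : nat.

Lemma gen_rank_le_size (s : seq gT) :
  <<[set z in s]>>%g = G -> 'm(G)%g <= size s.
Proof.
by move=> <-; apply: leq_trans (grank_min _) _; rewrite cardsE card_size.
Qed.

(** Padding a smallest generating set with the identity element. *)
Lemma generating_seq_exists a : 'm(G)%g <= a ->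
  exists s : seq gT,
    [/\ size s = a, all [in G] s & <<[set z in s]>>%g = G].
Proof.
move=> le_ma; have [B BG cardB] := grank_witness G.
exists (enum B ++ nseq (a - 'm(G)%g) 1%g); split.
- by rewrite size_cat size_nseq -cardE cardB subnKC.
- rewrite all_cat; apply/andP; split; apply/allP=> z.
    by rewrite mem_enum -BG; apply: mem_gen.
  by move/nseqP=> [-> _]; apply: group1.
apply/eqP; rewrite eqEsubset; apply/andP; split.
  rewrite gen_subG; apply/subsetP=> z; rewrite inE mem_cat mem_enum.
  case/orP=> [zB | /nseqP[-> _]]; last exact: group1.
  by rewrite -BG mem_gen.
rewrite -{1}BG genS //.
by apply/subsetP=> z zB; rewrite inE mem_cat mem_enum zB.
Qed.

(** The sequences over [gT] of length [a] with entries in [G] are the images of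
    the [a]-tuples over the subtype attached to [G], which are easy to count. *)
Lemma card_Gamma_diag a : #|Gamma G a a| = #|G| ^ a.
Proof.
rewrite card_sig /=.
have le_map (t : a.-tuple (subg_of G)) : size (map sgval t) <= a.
  by rewrite size_map size_tuple.
pose f t := Bseq (le_map t).
have f_inj : injective f.
  move=> t u /(congr1 val) /= /inj_map eq_tu; apply/val_inj/eq_tu.
  exact: subg_inj.
have <- : #|{: subg_of G}| = #|G| by rewrite card_sub; apply: eq_card.
rewrite -card_tuple -(card_image f_inj).
apply: eq_card => s; rewrite !inE orbb.
apply/andP/imageP=> [[/eqP size_s /allP sG] | [t _ ->]].
  have size_t : size (map (subg G) s) == a by rewrite size_map size_s.
  exists (Tuple size_t) => //; apply: val_inj => /=.
  rewrite -map_comp -[LHS]map_id; apply/eq_in_map=> z zs /=.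
  by rewrite subgK //; apply: sG.
split; first by rewrite /= size_map size_tuple.
by apply/allP=> _ /mapP[z _ ->]; apply: subgP.
Qed.

Section AtLoop.
Variables (a b : nat) (x : Gamma G a b).
Hypothesis xx : adj x x.

Lemma loop_eq_index : a = b.
Proof.
case/andP: xx => /orP[] /andP[/eqP size_a /eqP size_b] _; last first.
  exact: etrans (esym size_b) size_a.
exact: etrans (esym size_a) size_b.
Qed.

Lemma loop_generates :
  size (val x : seq gT) = a /\ <<[set z in (val x : seq gT)]>>%g = G.
Proof.
case/andP: xx => sz /eqP gen_xx; split.
  by case/orP: sz => /andP[/eqP size_a /eqP size_b].
rewrite -[RHS]gen_xx; congr (<<_>>)%g; apply/setP=> z.
by rewrite !inE mem_cat orbb.
Qed.

(** Enlarging a generating set inside [G] keeps it generating. *)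
Lemma loop_adj_all (y : Gamma G a b) : adj x y.
Proof.
have [size_x gen_x] := loop_generates.
case: y => s sP; have /andP[size_s /allP sG] := sP.
rewrite /adj /= /Gamma_adj /=; apply/andP; split.
  have ab : a == b by apply/eqP; apply: loop_eq_index.
  by move: size_s; rewrite !inE size_x eqxx ab /= orbC.
rewrite eqEsubset gen_subG; apply/andP; split.
  apply/subsetP=> z; rewrite inE mem_cat => /orP[zx | /sG //].
  by rewrite -gen_x mem_gen // inE.
rewrite -{1}gen_x genS //; apply/subsetP=> z; rewrite !inE mem_cat => ->.
by [].
Qed.

Lemma loop_no_isolated (y : Gamma G a b) : ~~ isolated y.
Proof.
by rewrite negb_forall; apply/existsP; exists x; rewrite adj_sym negbK loop_adj_all.
Qed.

Lemma loop_components : components (Gamma_star G a b) = [set [set: _]].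
Proof.
have xS : x \in [set y : Gamma G a b | ~~ isolated y].
  by rewrite inE loop_no_isolated.
pose x' : Gamma_star G a b := Sub x xS.
have cx (y : Gamma_star G a b) : connect adj x' y.
  exact/connect1/loop_adj_all.
have cc (y z : Gamma_star G a b) : connect adj y z.
  apply: connect_trans (cx z).
  apply: connect1; rewrite adj_sym; exact: loop_adj_all.
have pblockT (y : Gamma_star G a b) :
    [set z in [set: Gamma_star G a b] | connect adj y z] = setT.
  by apply/setP=> z; rewrite !inE cc.
apply/setP=> A; rewrite inE; apply/imsetP/eqP=> [[y _ ->] | ->].
  exact: pblockT.
by exists x'; rewrite ?inE ?pblockT.
Qed.

Lemma card_loop_Gamma_star : #|Gamma_star G a b| = #|G| ^ a.
Proof.
have -> : #|Gamma_star G a b| = #|Gamma G a b|.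
  by rewrite card_sig; apply: eq_card => y; rewrite !inE loop_no_isolated.
by rewrite -card_Gamma_diag -loop_eq_index.
Qed.

End AtLoop.

(** The loop identifies the component as a full graph [Gamma G a a], and its
    position is a generating [a]-tuple, which bounds [a] from below. *)
Lemma looped_component_order (C : Lambda_star G) :
  has_loop (Lambda_graph C) ->
  exists2 a, 'm(G)%g <= a & #|Lambda_graph C| = #|G| ^ a.
Proof.
case: C => a b le_ab A AP [[[x xS] /= xA]]; rewrite /= /induced_adj /= => xx.
have [size_x gen_x] := loop_generates xx.
exists a; first by rewrite -size_x gen_rank_le_size.
have defA : A = setT by apply/set1P; rewrite -(loop_components xx).
rewrite -(card_loop_Gamma_star xx) card_sig defA.
by apply: eq_card => y; rewrite !inE.
Qed.

Lemma looped_component_exists a : 'm(G)%g <= a ->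
  exists2 C : Lambda_star G,
    has_loop (Lambda_graph C) & #|Lambda_graph C| = #|G| ^ a.
Proof.
case/generating_seq_exists=> s [size_s sG gen_s].
have le_sa : size s <= a by rewrite size_s.
have sP : (size (Bseq le_sa) \in [:: a; a]) && all [in G] (Bseq le_sa).
  by rewrite !inE /= size_s eqxx.
pose x : Gamma G a a := Sub (Bseq le_sa) sP.
have xx : adj x x.
  rewrite /adj /= /Gamma_adj /= size_s eqxx /= -gen_s; apply/eqP.
  by congr (<<_>>)%g; apply/setP=> z; rewrite !inE mem_cat orbb.
have TP : [set: Gamma_star G a a] \in components (Gamma_star G a a).
  by rewrite (loop_components xx) inE.
have xS : x \in [set y : Gamma G a a | ~~ isolated y].
  by rewrite inE (loop_no_isolated xx).
exists (LambdaStar (leqnn a) TP).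
  by exists (Sub (Sub x xS : Gamma_star G a a) (in_setT _)).
rewrite -(card_loop_Gamma_star xx) card_sig.
by apply: eq_card => y; rewrite !inE.
Qed.

End LoopedComponents.

(** An isomorphism of graphs preserves loops and orders, so the orders of the
    looped members of the family for [G] occur in the family for [H]. *)
Lemma power_tail_incl (gT rT : finGroupType)
    (G : {group gT}) (H : {group rT}) :
  Lambda_star_eq G H ->
  forall i, 'm(G)%g <= i -> exists2 j, 'm(H)%g <= j & #|G| ^ i = #|H| ^ j.
Proof.
case=> f _ fiso i /looped_component_exists[C Cloop cardC].
have [j le_mj cardD] :=
  looped_component_order (graph_iso_has_loop (fiso C) Cloop).
by exists j => //; rewrite -cardC -cardD; apply: graph_iso_card.
Qed.

Lemma power_tail_min_le g h m n : 0 < h ->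
  (forall i, m <= i -> exists2 j, n <= j & g ^ i = h ^ j) -> h ^ n <= g ^ m.
Proof. by move=> h0 /(_ m (leqnn m))[j le_nj ->]; rewrite leq_pexp2l. Qed.

(** Two equal sets [{g ^ i | m <= i}] and [{h ^ j | n <= j}] of powers have the
    same least element and, if [1 < g] and [1 < h], the same second element;
    dividing gives [g = h], hence [m = n].  The powers of [1] do not record the
    exponent, so for base [1] its value has to be prescribed. *)
Lemma exponent_of_power_tail g h m n : 0 < g -> 0 < h ->
    (g = 1 -> m = 0) -> (h = 1 -> n = 0) ->
    (forall i, m <= i -> exists2 j, n <= j & g ^ i = h ^ j) ->
    (forall j, n <= j -> exists2 i, m <= i & h ^ j = g ^ i) ->
  m = n.
Proof.
move=> g0 h0 g1m h1n gh hg.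
have eq1 : g ^ m = h ^ n.
  by apply/eqP; rewrite eqn_leq (power_tail_min_le g0 hg) (power_tail_min_le h0 gh).
(* The power of [v] equal to [u ^ k.+1] exceeds the least one, [v ^ l]. *)
have succ_le u v k l : 1 < u -> 0 < v -> u ^ k = v ^ l ->
    (forall i, k <= i -> exists2 j, l <= j & u ^ i = v ^ j) ->
    v ^ l.+1 <= u ^ k.+1.
  move=> u1 v0 ukvl uv; have [j le_lj eq_j] := uv _ (leqnSn k).
  rewrite eq_j leq_pexp2l // ltn_neqAle le_lj andbT.
  apply: contraTneq (ltnSn k) => eq_lj.
  by rewrite -(ltn_exp2l _ _ u1) eq_j -eq_lj ukvl ltnn.
have base_eq1 u v k l : u = 1 -> 0 < v ->
    (forall j, l <= j -> exists2 i, k <= i & v ^ j = u ^ i) -> v = 1.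
  move=> -> v0 vu; have [i _ ] := vu _ (leqnSn l).
  by rewrite exp1n -[RHS](exp1n l.+1) => /eqP; rewrite eqn_exp2r // => /eqP.
have [g1 | g_neq1] := eqVneq g 1.
  by rewrite g1m // h1n //; apply: base_eq1 g1 h0 hg.
have [h1 | h_neq1] := eqVneq h 1.
  by rewrite g1m ?h1n //; apply: base_eq1 h1 g0 gh.
have g_gt1 : 1 < g by rewrite ltn_neqAle eq_sym g_neq1.
have h_gt1 : 1 < h by rewrite ltn_neqAle eq_sym h_neq1.
have eq2 : g ^ m.+1 = h ^ n.+1.
  by apply/eqP; rewrite eqn_leq !succ_le.
have eq_gh : g = h.
  move: eq2; rewrite !expnSr eq1 => /eqP.
  by rewrite eqn_pmul2l ?expn_gt0 ?h0 // => /eqP.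
by apply: (expnI g_gt1); rewrite eq1 eq_gh.
Qed.

Lemma gen_rank_order1 (gT : finGroupType) (G : {group gT}) :
  #|G| = 1 -> 'm(G)%g = 0.
Proof.
move/card1_trivg=> G1; apply/eqP; rewrite -leqn0.
apply: (@gen_rank_le_size gT G [::]); rewrite G1.
by rewrite (_ : [set z in [::]] = set0) ?gen0 //; apply/setP=> z; rewrite !inE.
Qed.

Theorem proposition5p7 (gT rT : finGroupType) (G : {group gT}) (H : {group rT})
    (eqGH : Lambda_star_eq G H) : ('m(G) = 'm(H))%g.
Proof.
apply: (@exponent_of_power_tail #|G| #|H|); rewrite ?cardG_gt0 //.
- exact: gen_rank_order1.
- exact: gen_rank_order1.
- exact: power_tail_incl.
- exact/power_tail_incl/Lambda_star_eq_sym.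
Qed.
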